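(* Let $G$ be a group and let $(V,\pi)$ be a partial representation of $G$ on a complex vector space $V$. Put $V_{g}=\pi(g)\pi(g^{-1})(V)$ for $g\in G$ and let $Z\subseteq\mathbb C[G]\otimes V$ be the subspace spanned by $\{hg\otimes v-h\otimes\pi(g)(v)\mid g,h\in G,\ v\in V_{g^{-1}}\}$. Then the globalization $\overline V=(\mathbb C[G]\otimes V)/Z$ of the partial representation (with $\mathbb C[G]$ acting by multiplication on the left tensorand, and with the linear map $V\to\overline V$, $v\mapsto 1_G\otimes v+Z$) coincides with the globalization of the geometric partial comodule over $\mathbb C[G]$ in $\mathsf{Vect}_{\mathbb C}^{\mathrm{op}}$ associated with $(V,\pi)$.
   Context: A partial representation of a group $G$ on a complex vector space $V$ is a map $\pi:G\to\mathrm{End}_{\mathbb C}(V)$ such that for all $g,h\in G$: (PR1) $\pi(1_G)=\mathrm{Id}_V$; (PR2) $\pi(g^{-1})\pi(gh)=\pi(g^{-1})\pi(g)\pi(h)$; (PR3) $\pi(gh)\pi(h^{-1})=\pi(g)\pi(h)\pi(h^{-1})$. Let $H=\mathbb C[G]$ with multiplication $\mu$, and let $\lambda:H\otimes V\to V$ be the linear map $g\otimes v\mapsto\pi(g)(v)$. The associated geometric partial comodule over the coalgebra $(H,\mu,u)$ in $\mathsf{Vect}_{\mathbb C}^{\mathrm{op}}$ is given, in terms of linear maps, by $H\bullet V=\{\sum_{g}g\otimes v_g\in H\otimes V\mid\sum_g\pi(k)\pi(g)(v_g)=\sum_g\pi(kg)(v_g)\ \forall k\in G\}$, $\pi_V:H\bullet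 V\to H\otimes V$ the inclusion and $\rho_V:H\bullet V\to V$ the restriction of $\lambda$. Its globalization (globalization of geometric partial comodules, spelled out in $\mathsf{Vect}_{\mathbb C}$) is a left $H$-module $Y$ with action $\nu:H\otimes Y\to Y$ and a linear map $\epsilon:V\to Y$ such that: (GL1) $\epsilon\circ\rho_V=\nu\circ(H\otimes\epsilon)\circ\pi_V$; (GL2) for every left $H$-module $(W,\nu_W)$ and every linear $g:V\to W$ with $g\circ\rho_V=\nu_W\circ(H\otimes g)\circ\pi_V$ there is a unique $H$-linear $\eta:Y\to W$ with $\eta\circ\epsilon=g$; (GL3) $(H\bullet V,\rho_V,\pi_V)$ is the pullback of $\epsilon:V\to Y$ and $\nu\circ(H\otimes\epsilon):H\otimes V\to Y$. It is unique up to unique isomorphism. *)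

(* Defs.v *)
From HB Require Import structures.
From mathcomp Require Import all_boot all_order all_algebra finmap.
From mathcomp Require Import boolp classical_sets reals.
From mathcomp.real_closed Require Import complex.
From mathcomp.multinomials Require Import monalg.

Set Implicit Arguments.
Unset Strict Implicit.
Unset Printing Implicit Defensive.

Import GRing.Theory.
Local Open Scope ring_scope.
Local Open Scope quotient_scope.

Section Span.
Variables (F : fieldType) (M : lmodType F) (S : set M).

Definition lspan : {pred M} := fun x : M =>
  `[< exists s : seq (F * M),
        (forall p, p \in s -> S p.2) /\ x = \sum_(p <- s) p.1 *: p.2 >].

Lemma lspanP x :
  reflect (exists s : seq (F * M),
             (forall p, p \in s -> S p.2) /\ x = \sum_(p <- s) p.1 *: p.2)
          (x \in lspan).
Proof. exact: asboolP. Qed.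

Lemma mem_lspan x : S x -> x \in lspan.
Proof.
move=> Sx; apply/lspanP; exists [:: (1, x)]; split; last first.
  by rewrite big_seq1 scale1r.
by move=> p; rewrite inE => /eqP ->.
Qed.

Fact lspan_submod_closed : submod_closed lspan.
Proof.
split=> [|a x y /lspanP[s [Ss ->]] /lspanP[t [St ->]]]; apply/lspanP.
  by exists [::]; rewrite big_nil.
exists ([seq (a * p.1, p.2) | p <- s] ++ t); split=> [p|].
  by rewrite mem_cat => /orP[/mapP[q /Ss Sq ->]|/St].
rewrite big_cat big_map scaler_sumr; congr (_ + _).
by apply: eq_bigr => p _; rewrite scalerA.
Qed.
HB.instance Definition _ :=
  GRing.isSubmodClosed.Build F M lspan lspan_submod_closed.

(* The quotient of M by the subspace spanned by S. *)
Definition lquot := Quotient.quot lspan.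
HB.instance Definition _ := GRing.Zmodule.on lquot.

Fact lproj_key : unit. Proof. exact: tt. Qed.
Definition lproj : M -> lquot := locked_with lproj_key \pi_lquot.
Canonical lproj_unlockable := [unlockable fun lproj].

Lemma lproj_eq x y : (lproj x == lproj y) = (x - y \in lspan).
Proof. by rewrite [lproj]unlock Quotient.idealrBE. Qed.

Fact lquot_scale_key : unit. Proof. exact: tt. Qed.
Definition lquot_scale : F -> lquot -> lquot :=
  locked_with lquot_scale_key (fun a y => lproj (a *: repr y)).
Canonical lquot_scale_unlockable := [unlockable of lquot_scale].

Lemma lprojK (y : lquot) : lproj (repr y) = y.
Proof. by rewrite [lproj]unlock reprK. Qed.

Lemma lprojZ a x : lquot_scale a (lproj x) = lproj (a *: x).
Proof.
apply/eqP; rewrite [lquot_scale]unlock lproj_eq -scalerBr rpredZ // -lproj_eq.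
by apply/eqP; exact: lprojK.
Qed.

Let lprojD x y : lproj (x + y) = lproj x + lproj y.
Proof. by rewrite [lproj]unlock !piE. Qed.

Fact lquot_scalerA a b v :
  lquot_scale a (lquot_scale b v) = lquot_scale (a * b) v.
Proof. by rewrite -[v]lprojK !lprojZ scalerA. Qed.
Fact lquot_scale1r : left_id 1 lquot_scale.
Proof. by move=> v; rewrite -[v]lprojK !lprojZ scale1r. Qed.
Fact lquot_scalerDr : right_distributive lquot_scale +%R.
Proof.
move=> a u v; rewrite -[u]lprojK -[v]lprojK.
by rewrite -lprojD !lprojZ -lprojD scalerDr.
Qed.
Fact lquot_scalerDl v : {morph lquot_scale^~ v : a b / a + b}.
Proof. by move=> a b; rewrite -[v]lprojK !lprojZ -lprojD scalerDl. Qed.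
HB.instance Definition _ := GRing.Zmodule_isLmodule.Build F lquot
  lquot_scalerA lquot_scale1r lquot_scalerDr lquot_scalerDl.

Fact lproj_is_linear : linear lproj.
Proof. by move=> a x y; rewrite lprojD -lprojZ. Qed.
HB.instance Definition _ := GRing.isLinear.Build F M lquot _ lproj
  lproj_is_linear.

Lemma lproj_eq0 x : (lproj x == 0) = (x \in lspan).
Proof. by rewrite -(linear0 lproj) lproj_eq subr0. Qed.

End Span.

Section SpanLift.
Variables (F : fieldType) (M W : lmodType F) (S : set M) (f : {linear M -> W}).

Lemma lspan_ker x : (forall z, S z -> f z = 0) -> x \in lspan S -> f x = 0.
Proof.
move=> fS /lspanP[s [Ss ->]]; rewrite linear_sum big_seq big1 // => p /Ss Sp.
by rewrite linearZ_LR fS // scaler0.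
Qed.

(* The proof argument makes the linear structure below inferable. *)
Definition lquot_lift of (forall z, S z -> f z = 0) : lquot S -> W :=
  fun y => f (repr y).

Hypothesis fS : forall z, S z -> f z = 0.

Lemma lquot_liftE x : lquot_lift fS (lproj S x) = f x.
Proof.
apply/eqP; rewrite -subr_eq0 -linearB; apply/eqP/(lspan_ker fS).
by rewrite -lproj_eq lprojK.
Qed.

Fact lquot_lift_is_linear : linear (lquot_lift fS).
Proof.
move=> a x y; rewrite -[x]lprojK -[y]lprojK -linearP !lquot_liftE.
exact: linearP.
Qed.
HB.instance Definition _ := GRing.isLinear.Build F (lquot S) W _
  (lquot_lift fS) lquot_lift_is_linear.

End SpanLift.

Section LinearExtension.
Variables (F : fieldType) (T : choiceType) (W : lmodType F) (h : T -> W).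

(* The linear extension of h, {malg F[T]} being the vector space with basis T. *)
Definition malg_lin (m : {malg F[T]}) : W := \sum_(k <- msupp m) m@_k *: h k.

Lemma malg_linEw (d : {fset T}) m : (msupp m `<=` d)%fset ->
  malg_lin m = \sum_(k <- d) m@_k *: h k.
Proof.
move=> le; rewrite [LHS](big_fset_incl _ le) => //= x xd /mcoeff_outdom ->.
by rewrite scale0r.
Qed.

Lemma malg_linU k c : malg_lin << c *g k >> = c *: h k.
Proof. by rewrite (malg_linEw msuppU_le) big_seq_fset1 mcoeffUU. Qed.

Fact malg_lin_is_linear : linear malg_lin.
Proof.
move=> a x y; set d := (msupp x `|` msupp y)%fset.
have le_xy : (msupp (a *: x + y) `<=` d)%fset.
  apply: fsubset_trans (msuppD_le _ _) _.
  by apply: fsetUSS (fsubset_refl _); exact: msuppZ_le.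
rewrite (malg_linEw le_xy) (malg_linEw (fsubsetUl _ (msupp y))).
rewrite (malg_linEw (fsubsetUr (msupp x) _)) scaler_sumr -big_split /=.
by apply: eq_bigr => k _; rewrite mcoeffD mcoeffZ scalerDl scalerA.
Qed.
HB.instance Definition _ := GRing.isLinear.Build F {malg F[T]} W _ malg_lin
  malg_lin_is_linear.

End LinearExtension.

Section Tensor.
Variables (F : fieldType) (U V : lmodType F).

Definition free_tens (u : U) (v : V) : {malg F[(U * V)%type]} := << (u, v) >>.

Variant tensor_rel : set {malg F[(U * V)%type]} :=
| TensorRelL a u u' v : tensor_rel
    (free_tens (a *: u + u') v - (a *: free_tens u v + free_tens u' v))
| TensorRelR a u v v' : tensor_rel
    (free_tens u (a *: v + v') - (a *: free_tens u v + free_tens u v')).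

(* The tensor product is the free vector space on U * V modulo bilinearity.  It
   is a notation rather than a constant so that unification does not have to go
   through an additional layer of structure instances. *)
Local Notation tensor := (lquot tensor_rel).

Fact tens_key : unit. Proof. exact: tt. Qed.
Definition tens : U -> V -> tensor :=
  locked_with tens_key (fun u v => lproj tensor_rel (free_tens u v)).
Canonical tens_unlockable := [unlockable fun tens].

Lemma tensE u v : tens u v = lproj tensor_rel (free_tens u v).
Proof. by rewrite unlock. Qed.

Fact tens_is_bilinear : bilinear_for *:%R *:%R tens.
Proof.
split=> [v a u u'|u a v v']; apply/eqP; rewrite !tensE -linearP lproj_eq.
  exact/mem_lspan/TensorRelL.
exact/mem_lspan/TensorRelR.
Qed.
HB.instance Definition _ := bilinear_isBilinear.Build F U V tensor *:%R *:%R
  tens tens_is_bilinear.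

Lemma tensor_gen (t : tensor) :
  exists s : seq (U * V), t = \sum_(p <- s) tens p.1 p.2.
Proof.
rewrite -[t]lprojK [repr t]monalgE linear_sum /=.
exists [seq ((repr t)@_p *: p.1, p.2) | p <- msupp (repr t)].
rewrite big_map; apply: eq_bigr => -[u v] _ /=.
rewrite linearZl_LR /= !tensE -(linearZ_LR (lproj _)).
congr lproj; apply/malgP => k.
by rewrite mcoeffZ !mcoeffU mulrnAr mulr1.
Qed.

End Tensor.

Notation tensor U V := (lquot (@tensor_rel _ U V)).

Section TensorLift.
Variables (F : fieldType) (U V W : lmodType F) (f : {bilinear U -> V -> W}).

Definition free_tens_lift : {malg F[(U * V)%type]} -> W :=
  malg_lin (fun p : U * V => f p.1 p.2).
HB.instance Definition _ := GRing.Linear.on free_tens_lift.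

Lemma free_tens_liftE u v : free_tens_lift (free_tens u v) = f u v.
Proof. by rewrite /free_tens_lift malg_linU scale1r. Qed.

Fact tens_lift_rel z : tensor_rel z -> free_tens_lift z = 0.
Proof.
case=> [a u u' v|a u v v']; rewrite linearB linearP /= !free_tens_liftE.
  by rewrite linearPl subrr.
by rewrite linearPr subrr.
Qed.

Fact tens_lift_key : unit. Proof. exact: tt. Qed.
Definition tens_lift : tensor U V -> W :=
  locked_with tens_lift_key (lquot_lift tens_lift_rel).
Canonical tens_lift_unlockable := [unlockable of tens_lift].

Fact tens_lift_is_linear : linear tens_lift.
Proof. by rewrite [tens_lift]unlock; exact: lquot_lift_is_linear. Qed.
HB.instance Definition _ := GRing.isLinear.Build F (tensor U V) W _ tens_lift
  tens_lift_is_linear.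

Lemma tens_liftE u v : tens_lift (tens u v) = f u v.
Proof. by rewrite unlock tensE lquot_liftE /= free_tens_liftE. Qed.

End TensorLift.

Lemma tensor_ext (F : fieldType) (U V W : lmodType F)
    (f g : {linear tensor U V -> W}) :
  (forall u v, f (tens u v) = g (tens u v)) -> f =1 g.
Proof.
move=> fg t; have [s ->] := tensor_gen t.
by rewrite !linear_sum; apply: eq_bigr => p _; exact: fg.
Qed.

Section TensorMap.
Variables (F : fieldType) (U U' V V' : lmodType F).
Variables (f : {linear U -> U'}) (g : {linear V -> V'}).

Definition tens_fun (u : U) (v : V) : tensor U' V' := tens (f u) (g v).

Fact tens_fun_is_bilinear : bilinear_for *:%R *:%R tens_fun.
Proof.
by split=> [v a u u'|u a v v']; rewrite /tens_fun linearP (linearPl, linearPr).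
Qed.
HB.instance Definition _ := bilinear_isBilinear.Build F U V _ *:%R *:%R
  tens_fun tens_fun_is_bilinear.

Definition tens_map : tensor U V -> tensor U' V' := tens_lift tens_fun.
HB.instance Definition _ := GRing.Linear.on tens_map.

Lemma tens_mapE u v : tens_map (tens u v) = tens (f u) (g v).
Proof. exact: tens_liftE. Qed.

End TensorMap.

Section GroupAlgebra.
Variables (F : fieldType) (G : groupType).

(* The ring structure monalg puts on {malg F[T]} excludes nontrivial
   invertible elements in T, hence the alias and the separate product. *)
Definition group_algebra := {malg F[G]}.
HB.instance Definition _ := GRing.Lmodule.on group_algebra.

Implicit Types a b c : group_algebra.

Definition galg (g : G) : group_algebra := << g >>.

Definition galg_one : group_algebra := galg 1%g.

Definition galg_mul a b : group_algebra :=
  \sum_(g <- msupp a) \sum_(h <- msupp b) << a@_g * b@_h *g (g * h)%g >>.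

Lemma galg_mulE a b :
  galg_mul a b = malg_lin (fun g => malg_lin (fun h => galg (g * h)%g) b) a.
Proof.
apply: eq_bigr => g _; rewrite scaler_sumr; apply: eq_bigr => h _.
rewrite scalerA; apply/malgP => k.
by rewrite mcoeffZ !mcoeffU mulrnAr mulr1.
Qed.

Fact galg_mul_linearl b : linear (galg_mul^~ b).
Proof. by move=> k a a'; rewrite !galg_mulE linearP. Qed.

Fact galg_mul_linearr a : linear (galg_mul a).
Proof.
move=> k b b'; rewrite !galg_mulE /malg_lin scaler_sumr -big_split /=.
apply: eq_bigr => g _; rewrite -!/(malg_lin _ _) linearP scalerDr !scalerA.
by rewrite mulrC.
Qed.

Lemma galg_mulG g h : galg_mul (galg g) (galg h) = galg (g * h)%g.
Proof. by rewrite galg_mulE /galg !malg_linU !scale1r. Qed.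

Lemma galgE a : a = \sum_(g <- msupp a) a@_g *: galg g.
Proof.
rewrite {1}[a]monalgE; apply: eq_bigr => g _; apply/malgP => k.
by rewrite mcoeffZ !mcoeffU mulrnAr mulr1.
Qed.

Lemma galg_ext (W : lmodType F) (f h : group_algebra -> W) :
  linear f -> linear h -> (forall g, f (galg g) = h (galg g)) -> f =1 h.
Proof.
move=> flin hlin fh a.
pose fL := GRing.isLinear.Build F group_algebra W _ f flin.
pose hL := GRing.isLinear.Build F group_algebra W _ h hlin.
pose fl : {linear group_algebra -> W} := HB.pack f fL.
pose hl : {linear group_algebra -> W} := HB.pack h hL.
rewrite -[f a]/(fl a) -[h a]/(hl a) (galgE a) !linear_sum.
by apply: eq_bigr => g _; rewrite !linearZ_LR /= fh.
Qed.

Fact galg_mulA : associative galg_mul.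
Proof.
move=> a b c; move: c; apply: galg_ext => [k x y|k x y|g3].
- by rewrite !galg_mul_linearr.
- by rewrite galg_mul_linearr.
move: b; apply: galg_ext => [k x y|k x y|g2].
- by rewrite galg_mul_linearl galg_mul_linearr.
- by rewrite galg_mul_linearr galg_mul_linearl.
move: a; apply: galg_ext => [k x y|k x y|g1].
- by rewrite galg_mul_linearl.
- by rewrite !galg_mul_linearl.
by rewrite !galg_mulG mulgA.
Qed.

Fact galg_mul1g : left_id galg_one galg_mul.
Proof.
apply: galg_ext => [k x y|//|g]; first by rewrite galg_mul_linearr.
by rewrite galg_mulG mul1g.
Qed.

Fact galg_mulg1 : right_id galg_one galg_mul.
Proof.
apply: galg_ext => [k x y|//|g]; first by rewrite galg_mul_linearl.
by rewrite galg_mulG mulg1.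
Qed.

Fact galg_mulDl : left_distributive galg_mul +%R.
Proof. by move=> a b c; have := galg_mul_linearl c 1 a b; rewrite !scale1r. Qed.

Fact galg_mulDr : right_distributive galg_mul +%R.
Proof. by move=> a b c; have := galg_mul_linearr a 1 b c; rewrite !scale1r. Qed.

Fact galg_one_neq0 : galg_one != 0.
Proof.
by apply/eqP/malgP=> /(_ 1%g) /eqP; rewrite !mcoeffsE oner_eq0.
Qed.

HB.instance Definition _ := GRing.Zmodule_isNzRing.Build group_algebra
  galg_mulA galg_mul1g galg_mulg1 galg_mulDl galg_mulDr galg_one_neq0.

Lemma galgM g h : galg g * galg h = galg (g * h)%g.
Proof. exact: galg_mulG. Qed.

Fact galg_scaleAl (k : F) a b : k *: (a * b) = (k *: a) * b.
Proof.
have := galg_mul_linearl b k a 0.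
by rewrite addr0 (mul0r b : galg_mul 0 b = 0) addr0 => /esym.
Qed.
HB.instance Definition _ := GRing.Lmodule_isLalgebra.Build F group_algebra
  galg_scaleAl.

Fact galg_scaleAr (k : F) a b : k *: (a * b) = a * (k *: b).
Proof.
have := galg_mul_linearr a k b 0.
by rewrite addr0 (mulr0 a : galg_mul a 0 = 0) addr0 => /esym.
Qed.
HB.instance Definition _ := GRing.Lalgebra_isAlgebra.Build F group_algebra
  galg_scaleAr.

End GroupAlgebra.

Section Globalization.
Variables (F : fieldType) (H : algType F).

Definition is_module (Y : lmodType F) (nu : {linear tensor H Y -> Y}) : Prop :=
  (forall y, nu (tens 1 y) = y) /\
  (forall h k y, nu (tens h (nu (tens k y))) = nu (tens (h * k) y)).

Definition is_module_hom (Y W : lmodType F) (nuY : {linear tensor H Y -> Y})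
    (nuW : {linear tensor H W -> W}) (eta : {linear Y -> W}) : Prop :=
  forall t, eta (nuY t) = nuW (tens_map idfun eta t).

Definition is_pullback (P A B C : lmodType F)
    (pA : {linear P -> A}) (pB : {linear P -> B})
    (f : {linear A -> C}) (g : {linear B -> C}) : Prop :=
  (forall p, f (pA p) = g (pB p)) /\
  forall (Q : lmodType F) (qA : {linear Q -> A}) (qB : {linear Q -> B}),
    (forall q, f (qA q) = g (qB q)) ->
    exists u : {linear Q -> P},
      ((forall q, pA (u q) = qA q) /\ (forall q, pB (u q) = qB q)) /\
      forall u' : {linear Q -> P},
        (forall q, pA (u' q) = qA q) /\ (forall q, pB (u' q) = qB q) ->
        u' =1 u.

(* The triple (H o V, rho_V, pi_V) underlying a geometric partial comodule V
   over H in the opposite of the category of vector spaces; the arrows are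
   written as linear maps, hence reversed.  The comodule axioms are not part of
   the record, as the notion of globalization only involves the triple. *)
Record pcomodule_data (V : lmodType F) := PComoduleData {
  pc_obj : lmodType F;
  pc_pi : {linear pc_obj -> tensor H V};
  pc_rho : {linear pc_obj -> V}
}.

Definition is_globalization (V : lmodType F) (X : pcomodule_data V)
    (Y : lmodType F) (nu : {linear tensor H Y -> Y}) (eps : {linear V -> Y}) :
    Prop :=
  [/\ is_module nu,
      forall x, eps (pc_rho X x) = nu (tens_map idfun eps (pc_pi X x)),
      forall (W : lmodType F) (nuW : {linear tensor H W -> W}),
        is_module nuW ->
        forall g : {linear V -> W},
          (forall x, g (pc_rho X x) = nuW (tens_map idfun g (pc_pi X x))) ->
          exists eta : {linear Y -> W},
            (is_module_hom nu nuW eta /\ forall v, eta (eps v) = g v) /\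
            forall eta' : {linear Y -> W},
              is_module_hom nu nuW eta' /\ (forall v, eta' (eps v) = g v) ->
              eta' =1 eta
    & is_pullback (pc_rho X) (pc_pi X) eps (nu \o tens_map idfun eps)].

End Globalization.

Definition is_partial_rep (F : fieldType) (G : groupType) (V : lmodType F)
    (pi : G -> {linear V -> V}) : Prop :=
  [/\ forall v, pi 1%g v = v,
      forall g h v, pi g^-1%g (pi (g * h)%g v) = pi g^-1%g (pi g (pi h v))
    & forall g h v, pi (g * h)%g (pi h^-1%g v) = pi g (pi h (pi h^-1%g v))].

Section PartialRepresentation.
Variables (F : fieldType) (G : groupType) (V : lmodType F).
Variable pi : G -> {linear V -> V}.
Local Notation H := (group_algebra F G).

(* The bilinear map (h, v) |-> sum_g h_g pi(g)(v). *)
Definition prep_fun (h : H) (v : V) : V := malg_lin (fun g => pi g v) h.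

Fact prep_fun_is_bilinear : bilinear_for *:%R *:%R prep_fun.
Proof.
split=> [v k a b|a k u v]; first by rewrite /prep_fun linearP.
rewrite /prep_fun /malg_lin /= scaler_sumr -big_split /=.
by apply: eq_bigr => g _; rewrite linearP scalerDr !scalerA mulrC.
Qed.
HB.instance Definition _ := bilinear_isBilinear.Build F H V V *:%R *:%R
  prep_fun prep_fun_is_bilinear.

Definition prep_act : tensor H V -> V := tens_lift prep_fun.
HB.instance Definition _ := GRing.Linear.on prep_act.

Lemma prep_actE g v : prep_act (tens (galg F g) v) = pi g v.
Proof. by rewrite /prep_act tens_liftE /= /prep_fun malg_linU scale1r. Qed.

(* The subspace of the sums of g (x) v_g over g in G such that
   sum_g pi(k)(pi(g)(v_g)) = sum_g pi(kg)(v_g) for all k; the finitely supported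
   family (v_g) is encoded as an element w of {malg V[G]}. *)
Definition bullet : {pred tensor H V} := fun x =>
  `[< exists w : {malg V[G]},
        x = \sum_(g <- msupp w) tens (galg F g) w@_g /\
        forall k : G, \sum_(g <- msupp w) pi k (pi g w@_g) =
                      \sum_(g <- msupp w) pi (k * g)%g w@_g >].

Section FamilySum.
Variables (W : lmodType F) (f : G -> V -> W).
Hypothesis flin : forall g, linear (f g).

Definition family_comb (a : F) (w w' : {malg V[G]}) : {malg V[G]} :=
  [malg g in msupp w => a *: w@_g] + w'.

Lemma family_sum_comb a w w' :
  \sum_(g <- msupp (family_comb a w w')) f g (family_comb a w w')@_g =
  a *: \sum_(g <- msupp w) f g w@_g + \sum_(g <- msupp w') f g w'@_g.
Proof.
have f0 g : f g 0 = 0.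
  by have := flin g (-1) 0 0; rewrite scaler0 addr0 scaleN1r addNr.
have fw (d : {fset G}) u : (msupp u `<=` d)%fset ->
    \sum_(g <- msupp u) f g u@_g = \sum_(g <- d) f g u@_g.
  by move=> le; apply: (big_fset_incl _ le) => x xd /mcoeff_outdom ->.
have scE g : [malg g in msupp w => a *: w@_g]@_g = a *: w@_g.
  by rewrite mcoeffE; case: msuppP => // _; rewrite scaler0.
set u := family_comb a w w'; set d := (msupp u `|` (msupp w `|` msupp w'))%fset.
have le_w : (msupp w `<=` d)%fset.
  by rewrite /d fsubsetU // fsubsetUl orbT.
have le_w' : (msupp w' `<=` d)%fset.
  by rewrite /d fsubsetU // fsubsetUr orbT.
rewrite (fw d u) ?fsubsetUl // (fw d w) // (fw d w') //.
rewrite scaler_sumr -big_split /=; apply: eq_bigr => g _.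
by rewrite /u /family_comb mcoeffD scE flin.
Qed.

End FamilySum.

Fact bullet_submod_closed : submod_closed bullet.
Proof.
split=> [|a x y /asboolP[w [-> wE]] /asboolP[w' [-> w'E]]]; apply/asboolP.
  by exists 0; split=> [|k]; rewrite msupp0 !big_seq_fset0.
exists (family_comb a w w'); split=> [|k].
  rewrite (@family_sum_comb _ (fun g => tens (galg F g))) // => g b u v.
  exact: linearPr.
rewrite (@family_sum_comb _ (fun g v => pi k (pi g v))); last first.
  by move=> g b u v /=; rewrite !linearP.
rewrite (@family_sum_comb _ (fun g v => pi (k * g)%g v)); last first.
  by move=> g b u v /=; rewrite !linearP.
by rewrite wE w'E.
Qed.
HB.instance Definition _ :=
  GRing.isSubmodClosed.Build F (tensor H V) bullet bullet_submod_closed.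

Definition bullet_obj := {x : tensor H V | x \in bullet}.
HB.instance Definition _ := Choice.on bullet_obj.
HB.instance Definition _ := SubType.on bullet_obj.
HB.instance Definition _ := [SubChoice_isSubLmodule of bullet_obj by <:].

Definition bullet_pi (x : bullet_obj) : tensor H V := val x.
Fact bullet_pi_is_linear : linear bullet_pi.
Proof. by []. Qed.
HB.instance Definition _ := GRing.isLinear.Build F bullet_obj _ _ bullet_pi
  bullet_pi_is_linear.

Definition bullet_rho (x : bullet_obj) : V := prep_act (bullet_pi x).
Fact bullet_rho_is_linear : linear bullet_rho.
Proof. by move=> a x y; rewrite /bullet_rho !linearP. Qed.
HB.instance Definition _ := GRing.isLinear.Build F bullet_obj V _ bullet_rho
  bullet_rho_is_linear.

Definition prep_comodule : pcomodule_data H V :=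
  PComoduleData bullet_pi bullet_rho.

(* The subspace V_g. *)
Definition prep_dom (g : G) : set V := range (fun v => pi g (pi g^-1%g v)).

Variant glob_rel : set (tensor H V) :=
| GlobRel g h v of prep_dom g^-1%g v : glob_rel
    (tens (galg F (h * g)%g) v - tens (galg F h) (pi g v)).

Local Notation glob_space := (lquot glob_rel).

Definition glob_map (v : V) : glob_space := lproj glob_rel (tens 1 v).
Fact glob_map_is_linear : linear glob_map.
Proof. by move=> a u v; rewrite /glob_map linearPr linearP. Qed.
HB.instance Definition _ := GRing.isLinear.Build F V glob_space _ glob_map
  glob_map_is_linear.

(* Left multiplication by h on the left tensorand. *)
Definition lmul_tens (h : H) : tensor H V -> tensor H V :=
  tens_map (h \*o idfun) idfun.
HB.instance Definition _ h := GRing.Linear.on (lmul_tens h).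

Lemma lmul_tensE h k v : lmul_tens h (tens k v) = tens (h * k) v.
Proof. exact: tens_mapE. Qed.

Lemma lmul_tens_linearl x : linear (lmul_tens^~ x).
Proof.
move=> a h h'; have [s ->] := tensor_gen x.
rewrite !(linear_sum (lmul_tens _)) /= scaler_sumr -big_split /=.
apply: eq_bigr => p _.
by rewrite !lmul_tensE mulrDl -scalerAl linearPl.
Qed.

Lemma lmul_glob_rel h z : glob_rel z -> (lproj glob_rel \o lmul_tens h) z = 0.
Proof.
move=> zZ; pose f (k : H) := lproj glob_rel (lmul_tens k z).
apply: (@galg_ext F G glob_space f (fun=> 0)) => [a k l|a k l|l].
- by rewrite /f lmul_tens_linearl (linearP (lproj glob_rel)).
- by rewrite scaler0 addr0.
rewrite /f; case: zZ => g k v vD; apply/eqP; rewrite lproj_eq0.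
rewrite (linearB (lmul_tens _)) /= !lmul_tensE !galgM mulgA.
exact/mem_lspan/GlobRel.
Qed.

Definition glob_mul (h : H) (y : glob_space) : glob_space :=
  lquot_lift (f := lproj glob_rel \o lmul_tens h) (lmul_glob_rel h) y.

Lemma glob_mulE h x :
  glob_mul h (lproj glob_rel x) = lproj glob_rel (lmul_tens h x).
Proof. exact: lquot_liftE. Qed.

Fact glob_mul_is_bilinear : bilinear_for *:%R *:%R glob_mul.
Proof.
split=> [y a h h'|h a x y].
  by rewrite -[y]lprojK !glob_mulE lmul_tens_linearl linearP.
exact: linearP.
Qed.
HB.instance Definition _ := bilinear_isBilinear.Build F H glob_space glob_space
  *:%R *:%R glob_mul glob_mul_is_bilinear.

Definition glob_act : tensor H glob_space -> glob_space := tens_lift glob_mul.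
HB.instance Definition _ := GRing.Linear.on glob_act.

Lemma glob_actE h x :
  glob_act (tens h (lproj glob_rel x)) = lproj glob_rel (lmul_tens h x).
Proof. by rewrite /glob_act tens_liftE /= glob_mulE. Qed.

End PartialRepresentation.

Notation glob_space pi := (lquot (glob_rel pi)).

Arguments glob_act {F G V} pi _.

(* Main.v *)
Require Import Defs.
From HB Require Import structures.
From mathcomp Require Import all_boot all_order all_algebra finmap.
From mathcomp Require Import boolp reals.
From mathcomp.real_closed Require Import complex.
From mathcomp.multinomials Require Import monalg.

Set Implicit Arguments.
Unset Strict Implicit.
Unset Printing Implicit Defensive.

Import GRing.Theory.
Local Open Scope ring_scope.

(** Write x = sum_g g (x) v_g for an element of C[G] (x) V, and consider its
    translates: for k in G, the vector Phi_k(x) = sum_g pi(kg)(v_g), which is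
    the value of the partial action on k x.  Everything rests on the identity

      Z = { x | Phi_k(x) = 0 for all k in G }.

    The inclusion from left to right is (PR3), which on V_{g^-1} reads
    pi(kg) = pi(k) pi(g) ([prep_domM]).  The converse
    ([translate_act_ker]) is an induction on the number of terms g (x) v_g:
    if h is one of the group elements that occur, Phi_{h^-1}(x) = 0 expresses
    v_h by the other v_g, and the part of each v_g lying in
    V_{(h^-1 g)^-1} can be moved to the position h modulo Z.  There it cancels
    what v_h contributes, so h disappears.

    On the other hand, x belongs to the object H o V of the comodule exactly
    when Phi_k(x) = pi(k)(lambda(x)) for all k ([bulletP]).  As
    Phi_k(1 (x) v) = pi(k)(v), the identity above says that x and 1 (x) v have
    the same class modulo Z if and only if x is in H o V and lambda(x) = v
    ([lproj_glob_mapP]).  Since x |-> x + Z is the composite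
    nu o (H (x) epsilon) ([glob_actG]), this equivalence contains both (GL1),
    the commutation of the square, and (GL3), that it is a pullback.

    For (GL2), the map nu_W o (H (x) f) kills the generators of Z because
    g (x) v is in H o V when v is in V_{g^-1}; uniqueness holds because the
    image of V generates the quotient as a module. *)

Lemma tens_galg_ext (F : fieldType) (G : groupType) (V W : lmodType F)
    (f f' : {linear tensor (group_algebra F G) V -> W}) :
  (forall g v, f (tens (galg F g) v) = f' (tens (galg F g) v)) -> f =1 f'.
Proof.
move=> ff'; apply: tensor_ext => a v.
move: a; apply: galg_ext => [k a b|k a b|g //]; by rewrite linearPl linearP.
Qed.

(** The right-hand arrow of the pullback square, nu o (H (x) epsilon), is the
    canonical projection onto the quotient by Z. *)
Lemma glob_actG (F : fieldType) (G : groupType) (V : lmodType F)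
    (pi : G -> {linear V -> V}) (x : tensor (group_algebra F G) V) :
  glob_act pi (tens_map idfun (glob_map pi) x) = lproj (glob_rel pi) x.
Proof.
move: x; apply: (tensor_ext (f := glob_act pi \o tens_map idfun (glob_map pi))).
by move=> a v /=; rewrite tens_mapE glob_actE lmul_tensE mulr1.
Qed.

Lemma glob_act_module (F : fieldType) (G : groupType) (V : lmodType F)
    (pi : G -> {linear V -> V}) : is_module (glob_act pi).
Proof.
split=> [y|h k y]; rewrite -[y]lprojK /= !glob_actE.
  congr (lproj _ _); move: (repr y); apply: (tensor_ext (g := idfun)) => a v.
  by rewrite /= lmul_tensE mul1r.
congr (lproj _ _); move: (repr y).
apply: (tensor_ext (f := lmul_tens h \o lmul_tens k)) => a v /=.
by rewrite !lmul_tensE mulrA.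
Qed.

Section Translates.
Variables (F : fieldType) (G : groupType) (V : lmodType F).
Variable pi : G -> {linear V -> V}.
Local Notation H := (group_algebra F G).

(** Membership in [bullet] asks for a finitely supported family indexed by G,
    whereas a general tensor is given by pairs with first entry in the group
    algebra; collecting the coefficients of each group element makes every
    tensor available in the former shape. *)
Lemma tensor_family (x : tensor H V) :
  exists w : {malg V[G]}, x = \sum_(g <- msupp w) tens (galg F g) w@_g.
Proof.
pose famP (y : tensor H V) := exists w : {malg V[G]},
  y = \sum_(g <- msupp w) tens (galg F g) w@_g.
have fam0 : famP 0 by exists 0; rewrite msupp0 big_seq_fset0.
have famD y1 y2 : famP y1 -> famP y2 -> famP (y1 + y2).
  move=> [w1 ->] [w2 ->]; exists (family_comb 1 w1 w2).
  rewrite (@family_sum_comb _ _ _ _ (fun g => tens (galg F g))) ?scale1r //.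
  by move=> g b u v; exact: linearPr.
have [s ->] := tensor_gen x.
apply: (big_ind famP) => // -[a v] _ /=.
rewrite [a]galgE linear_sumlz; apply: (big_ind famP) => // g _.
exists << a@_g *: v *g g >>; rewrite linearZl_LR -linearZr_LR.
rewrite [RHS](big_fset_incl _ msuppU_le) /=; last first.
  by move=> h _ /mcoeff_outdom ->; rewrite linear0r.
by rewrite big_seq_fset1 mcoeffUU.
Qed.

(** The map Phi_k : sum_g g (x) v_g |-> sum_g pi(kg)(v_g). *)
Definition translate_act (k : G) : tensor H V -> V :=
  prep_act pi \o lmul_tens (galg F k).
HB.instance Definition _ k := GRing.Linear.on (translate_act k).

Lemma translate_actE k g v :
  translate_act k (tens (galg F g) v) = pi (k * g)%g v.
Proof. by rewrite /translate_act /= lmul_tensE galgM prep_actE. Qed.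

(** Both sides are linear in the tensor, so that the condition defining the
    subspace does not depend on the family chosen to represent it. *)
Lemma bulletP x :
  reflect (forall k, pi k (prep_act pi x) = translate_act k x)
          (x \in bullet pi).
Proof.
apply: (iffP (asboolP _)) => [[w [-> wE]] k|xE].
  rewrite !linear_sum /=; under eq_bigr do rewrite prep_actE.
  by rewrite wE; apply: eq_bigr => g _; rewrite translate_actE.
have [w xw] := tensor_family x; exists w; split=> // k.
have := xE k; rewrite xw !linear_sum /=.
under eq_bigr do rewrite prep_actE.
by under [in RHS]eq_bigr do rewrite translate_actE.
Qed.

Hypothesis pi_partial : is_partial_rep pi.

(** A vector of V_{g^-1} has the form pi(g^-1)(w), which is where (PR3) makes
    pi multiplicative. *)
Lemma prep_domM k g v : prep_dom pi g^-1%g v -> pi (k * g)%g v = pi k (pi g v).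
Proof.
by have [_ _ pi3] := pi_partial; case=> u _ <-; rewrite invgK pi3.
Qed.

Lemma tens_prep_dom_bullet g v :
  prep_dom pi g^-1%g v -> tens (galg F g) v \in bullet pi.
Proof.
move=> vD; apply/bulletP => k.
by rewrite prep_actE translate_actE prep_domM.
Qed.

Lemma translate_act_lspan k x :
  x \in lspan (glob_rel pi) -> translate_act k x = 0.
Proof.
apply: lspan_ker => _ [g h v vD].
by rewrite linearB /= !translate_actE mulgA prep_domM // subrr.
Qed.

(** The inclusion of the joint kernel of the maps Phi_k in Z.  With h fixed,
    pi(g^-1 h) pi(h^-1 g) is a projection of V onto V_{(h^-1 g)^-1}; it splits
    v_g into a part that Z allows to be moved from g to h, and a part that
    stays at g.  The moved parts add up to -v_h, and x is congruent modulo Z to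
    the sum of the parts left behind, which has one term fewer.  It is still in
    the joint kernel, since Z is. *)
Lemma translate_act_ker x :
  (forall k, translate_act k x = 0) -> x \in lspan (glob_rel pi).
Proof.
have [pi1 pi2 _] := pi_partial.
have [w ->] := tensor_family x.
rewrite -(big_map (fun g => (g, w@_g)) xpredT
                  (fun p : G * V => tens (galg F p.1) p.2)).
(* The induction runs over arbitrary lists of pairs: group elements may repeat,
   as only the length has to decrease. *)
move: [seq _ | _ <- _] => {x w} s.
have [n] := ubnP (size s); elim: n s => // n IHn [|[h v] s] /= les xE.
  by rewrite big_nil rpred0.
pose q (p : G * V) := pi (p.1^-1 * h)%g (pi (h^-1 * p.1)%g p.2).
(* As (h^-1 g)^-1 = g^-1 h, q is the projection of v_g that is moved to h. *)
have qD p : prep_dom pi (h^-1 * p.1)^-1%g (q p).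
  by exists p.2 => //; rewrite invgK invgM invgK.
(* Moving v_g and moving its projection have the same effect: (PR2). *)
have piq p : pi (h^-1 * p.1)%g (q p) = pi (h^-1 * p.1)%g p.2.
  rewrite /q -[(p.1^-1 * h)%g]invgK invgM invgK.
  set g := (h^-1 * p.1)%g.
  have := pi2 g^-1%g g p.2.
  by rewrite invgK mulVg pi1 => /esym.
(* The parts left behind at each g. *)
pose s' := [seq (p.1, p.2 - q p) | p <- s].
(* The equation Phi_(h^-1)(x) = 0, solved for v. *)
have vE : v = - \sum_(p <- s) pi (h^-1 * p.1)%g p.2.
  have /eqP := xE h^-1%g; rewrite big_cons linearD linear_sum /=.
  rewrite translate_actE mulVg pi1 addr_eq0 => /eqP ->; congr (- _).
  by apply: eq_bigr => p _; rewrite translate_actE.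
pose z := \sum_(p <- s) (tens (galg F p.1) (q p) -
                         tens (galg F h) (pi (h^-1 * p.1)%g (q p))).
have zZ : z \in lspan (glob_rel pi).
  apply: rpred_sum => p _; apply: mem_lspan.
  rewrite -{1}[p.1](mulVKg h); exact: GlobRel.
have xz : \sum_(p <- (h, v) :: s) tens (galg F p.1) p.2 =
    \sum_(p <- s') tens (galg F p.1) p.2 + z.
  rewrite big_cons big_map /= vE linearNr linear_sumr -sumrN -!big_split /=.
  by apply: eq_bigr => p _; rewrite piq linearBr addrA subrK addrC.
rewrite xz rpredD // IHn ?size_map // => k.
have := xE k.
by rewrite xz linearD /= (translate_act_lspan k zZ) addr0.
Qed.

(** The pullback of epsilon and of the projection onto the quotient, computed
    elementwise: it is the graph of lambda over H o V. *)
Lemma lproj_glob_mapP x v :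
  lproj (glob_rel pi) x = glob_map pi v <->
  x \in bullet pi /\ prep_act pi x = v.
Proof.
have [pi1 _ _] := pi_partial.
have act1 : translate_act 1%g x = prep_act pi x.
  move: x; apply: tens_galg_ext => g u.
  by rewrite /= translate_actE prep_actE mul1g.
have actv k : translate_act k (tens 1 v) = pi k v.
  by have := translate_actE k 1%g v; rewrite mulg1.
split=> [/eqP|[/bulletP xE vE]].
  rewrite /glob_map lproj_eq => xvZ.
  have xE k : translate_act k x = pi k v.
    apply/eqP; rewrite -actv -subr_eq0 -linearB.
    exact/eqP/translate_act_lspan.
  have vE : prep_act pi x = v by rewrite -act1 xE pi1.
  by split=> //; apply/bulletP => k; rewrite vE xE.
apply/eqP; rewrite /glob_map lproj_eq; apply: translate_act_ker => k.
by rewrite linearB /= actv -xE vE subrr.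
Qed.

Lemma glob_map_rho (x : bullet_obj pi) :
  glob_map pi (bullet_rho x) =
  glob_act pi (tens_map idfun (glob_map pi) (bullet_pi x)).
Proof.
by rewrite glob_actG; apply/esym/lproj_glob_mapP; split=> //; exact: valP.
Qed.

Lemma glob_universal (W : lmodType F) (nu : {linear tensor H W -> W})
    (f : {linear V -> W}) :
  is_module nu ->
  (forall x : bullet_obj pi,
     f (bullet_rho x) = nu (tens_map idfun f (bullet_pi x))) ->
  exists eta : {linear glob_space pi -> W},
    (is_module_hom (glob_act pi) nu eta /\
     forall v, eta (glob_map pi v) = f v) /\
    forall eta' : {linear glob_space pi -> W},
      is_module_hom (glob_act pi) nu eta' /\
      (forall v, eta' (glob_map pi v) = f v) -> eta' =1 eta.
Proof.
move=> [nu1 nuM] fE.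
pose fW : {linear tensor H V -> W} := nu \o tens_map idfun f.
have fWE a v : fW (tens a v) = nu (tens a (f v)) by rewrite /fW /= tens_mapE.
have fW0 z : glob_rel pi z -> fW z = 0.
  case=> g h v vD; rewrite linearB !fWE -galgM -nuM.
  (* On g (x) v the hypothesis says that f(pi(g)(v)) = g f(v). *)
  pose b : bullet_obj pi :=
    exist (fun x => x \in bullet pi) _ (tens_prep_dom_bullet vD).
  have := fE b.
  rewrite /bullet_rho /bullet_pi /= prep_actE tens_mapE => ->.
  by rewrite subrr.
(* The lift is kept abstract: simplification would otherwise unfold it to its
   value at a representative. *)
have [eta etaL] : exists eta : {linear glob_space pi -> W},
    forall x, eta (lproj (glob_rel pi) x) = fW x.
  by exists (lquot_lift fW0) => x; exact: lquot_liftE.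
exists eta; split; first split.
- apply: (tensor_ext (f := eta \o glob_act pi)
                     (g := nu \o tens_map idfun eta)) => a y.
  rewrite -[y]lprojK /= tens_mapE glob_actE !etaL.
  have [s ->] := tensor_gen (repr y).
  rewrite !linear_sum linear_sumr linear_sum; apply: eq_bigr => -[b v] _ /=.
  by rewrite lmul_tensE !tens_mapE nuM.
- by move=> v; rewrite /glob_map etaL fWE nu1.
move=> eta' [eta'H eta'E] y; rewrite -[y]lprojK etaL -glob_actG eta'H.
move: (repr y); apply: (tensor_ext
  (f := nu \o tens_map idfun eta' \o tens_map idfun (glob_map pi))) => a v.
by rewrite /= !tens_mapE /= eta'E.
Qed.

Lemma glob_pullback :
  is_pullback (@bullet_rho _ _ _ pi) (@bullet_pi _ _ _ pi) (glob_map pi)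
    (glob_act pi \o tens_map idfun (glob_map pi)).
Proof.
split=> [|Q qA qB qE]; first exact: glob_map_rho.
have qP q : qB q \in bullet pi /\ prep_act pi (qB q) = qA q.
  by apply/lproj_glob_mapP; rewrite -glob_actG; exact/esym/qE.
pose u q : bullet_obj pi := exist (fun x => x \in bullet pi) (qB q) (qP q).1.
have u_lin : linear u by move=> a q q'; apply: val_inj; rewrite /= linearP.
pose uL := GRing.isLinear.Build _ Q (bullet_obj pi) _ u u_lin.
pose ul : {linear Q -> bullet_obj pi} := HB.pack u uL.
exists ul; split; first by split=> q //; exact: (qP q).2.
by move=> u' [_ u'B] q; apply: val_inj; exact: u'B.
Qed.

End Translates.

Theorem corollary3p18 (R : realType) (G : groupType) (V : lmodType R[i])
    (pi : G -> {linear V -> V}) (pi_partial : is_partial_rep pi) :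
  is_globalization (prep_comodule pi) (Y := glob_space pi)
    (glob_act pi) (glob_map pi).
Proof.
split.
- exact: glob_act_module.
- exact: glob_map_rho.
- by move=> W nu nu_mod f; exact: glob_universal.
exact: glob_pullback.
Qed.
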